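(* Let $G$ be a finite simple bipartite graph without isolated vertices with $\operatorname{ind-match}(G)=\operatorname{ord-match}(G)$, let $V(G)=\{x_1,\dots,x_d\}$ with $d=|V(G)|$, let $K$ be a field, and let $S=K[x_1,\dots,x_d]$. Let $J(G)=\bigcap_{x_ix_j\in E(G)}(x_i,x_j)\subset S$ be the cover ideal of $G$. Then for every integer $k\ge 1$, $$\operatorname{depth}(S/J(G)^k)=d-\operatorname{ind-match}(G)-1.$$
   Context: Graphs have non-empty vertex set; the vertices of $G$ are identified with the variables of $S$. A matching in $G$ is a set of pairwise disjoint edges. An induced matching is a matching such that no two of its edges are joined by an edge of $G$; $\operatorname{ind-match}(G)$ is the largest size of an induced matching. An ordered matching is a matching whose edges can be written as $a_1b_1,\dots,a_rb_r$ (for some ordering of the edges and some choice of endpoints) such that $\{a_1,\dots,a_r\}$ is an independent set of $G$ and $a_ib_j\in E(G)$ implies $i\le j$; $\operatorname{ord-match}(G)$ is the largest size of an ordered matching. *)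

(* Defs.v *)
From HB Require Import structures.
From mathcomp Require Import all_boot all_order all_algebra.
From mathcomp Require Import mpoly.

Set Implicit Arguments.
Unset Strict Implicit.
Unset Printing Implicit Defensive.

Import GRing.Theory.
Local Open Scope ring_scope.

Section Graphs.

Variables (T : finType) (e : rel T).

Definition edge_set : {set {set T}} :=
  [set [set p.1; p.2] | p : T * T & e p.1 p.2].

Definition bipartite : Prop :=
  exists A : {set T}, forall x y, e x y -> (x \in A) != (y \in A).

Definition no_isolated : Prop := forall x, exists y, e x y.

Definition matching (M : {set {set T}}) : bool :=
  (M \subset edge_set) && trivIset M.

Definition induced_matching (M : {set {set T}}) : bool :=
  matching M &&
  [forall A in M, forall B in M,
     (A != B) ==> [forall x in A, forall y in B, ~~ e x y]].

(* Since there are [#|M|] indices, [i |-> [set a i; b i]] enumerates the edges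
   of [M] without repetition. *)
Definition ordered_matching (M : {set {set T}}) : bool :=
  matching M &&
  [exists a : {ffun 'I_#|M| -> T}, exists b : {ffun 'I_#|M| -> T},
    [&& M == [set [set a i; b i] | i : 'I_#|M|],
        [forall i, forall j, ~~ e (a i) (a j)] &
        [forall i, forall j, e (a i) (b j) ==> (i <= j)%N]]].

Definition ind_match : nat := \max_(M | induced_matching M) #|M|.

Definition ord_match : nat := \max_(M | ordered_matching M) #|M|.

End Graphs.

(* Ideals, and more generally subsets of a ring, are [Prop]-valued predicates. *)
Section Ideals.

Variable R : comNzRingType.

Definition ideal_span (A : R -> Prop) (f : R) : Prop :=
  exists s : seq (R * R),
    (forall p, p \in s -> A p.2) /\ f = \sum_(p <- s) p.1 * p.2.

Definition ideal_pow (I : R -> Prop) (k : nat) : R -> Prop :=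
  ideal_span (fun f => exists t : k.-tuple R,
    (forall g, g \in t -> I g) /\ f = \prod_(g <- t) g).

Definition ideal_add_seq (I : R -> Prop) (s : seq R) : R -> Prop :=
  ideal_span (fun f => I f \/ f \in s).

(* [s] is a regular sequence on the module [M = R / I], with elements of [M]
   replaced by representatives in [R]: [M / (s_0, ..., s_(i-1)) M] is
   [R / (I + (s_0, ..., s_(i-1)))], and the last clause says [M <> (s) M]. *)
Definition quot_regular_seq (I : R -> Prop) (s : seq R) : Prop :=
  (forall i, (i < size s)%N -> forall g,
     ideal_add_seq I (take i s) (s`_i * g) -> ideal_add_seq I (take i s) g)
  /\ ~ ideal_add_seq I s 1.

End Ideals.

Section PolynomialRing.

Variables (K : fieldType) (d : nat).

Definition irrelevant_ideal : {mpoly K[d]} -> Prop :=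
  ideal_span (fun f => exists i : 'I_d, f = 'X_i).

(* [n] is the depth of [S / I], [S = K[x_1, ..., x_d]]: the largest length of a
   regular sequence on [S / I] contained in the ideal [(x_1, ..., x_d)]. *)
Definition is_quot_depth (I : {mpoly K[d]} -> Prop) (n : nat) : Prop :=
  let regular s :=
    (forall f, f \in s -> irrelevant_ideal f) /\ quot_regular_seq I s in
  (exists2 s, regular s & size s = n) /\
  (forall s, regular s -> (size s <= n)%N).

Definition cover_ideal (e : rel 'I_d) (f : {mpoly K[d]}) : Prop :=
  forall i j : 'I_d, e i j -> ideal_span (fun g => g = 'X_i \/ g = 'X_j) f.

End PolynomialRing.

(* Main.v *)
From HB Require Import structures.
Require Import Defs.
From mathcomp Require Import all_boot all_order all_algebra.
From mathcomp Require Import mpoly.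
From mathcomp Require Import zify ring.

Set Implicit Arguments.
Unset Strict Implicit.
Unset Printing Implicit Defensive.

Import GRing.Theory.
Local Open Scope ring_scope.

(** The proof bounds the depth from below by an explicit regular sequence and from
    above by a nonzero Koszul homology class.  Write [nu] for the common value of
    the two matching numbers and [I = J(G)^k].  As [G] is bipartite, [I] is the
    monomial ideal of the [x^m] with [m_i + m_j >= k] on every edge: such a
    monomial is divisible by a product of [k] vertex covers ([ideal_pow_cover]).

    Lower bound.  The elementary symmetric polynomials [e_1, ..., e_n] restrict
    on each coordinate subspace to elementary symmetric polynomials, and form a
    regular sequence there as soon as at least [n] variables survive
    ([weakly_regular_mesyms]).  By the exact sequence
    [0 -> S/(I : x) -> S/I -> S/(I, x) -> 0], a sequence that is regular on both
    ends is regular in the middle ([weakly_regular_colon]).  Branching repeatedly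
    in this way decomposes [S/I] into quotients [S/(Z)] by sets of variables.
    Taking at each step a vertex with minimal accumulated exponent among those
    that still lie on an unsatisfied edge, the vertices set to zero are, except
    for the last one, the first endpoints of an ordered matching, so each [Z] has
    at most [nu + 1] elements ([state_regular_avoiding]).  Thus
    [e_1, ..., e_n] with [n = d - nu - 1] is regular on [S/I].

    Upper bound.  A regular sequence of length [r] in the ideal generated by the
    variables makes the Koszul homology of [S/I] on all variables vanish in
    degrees [> d - r] ([koszul_exact_regular]).  By a graded Nakayama argument
    the vanishing in a given range of degrees persists when variables are removed
    from the Koszul complex ([koszul_exact_drop]).  For an induced matching
    [a_1 b_1, ..., a_nu b_nu], keep only the variables [a_i], [b_i].  The product
    of the [a_i e_(b_i) - b_i e_(a_i)], times a monomial that satisfies all edges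
    except the matched ones and misses those by one, lies in [I] and is the
    boundary of a chain which is therefore a cycle of degree [nu + 1] modulo [I];
    it is not a boundary, as one coefficient shows ([koszul_not_exact]).  Hence
    [nu + 1 <= d - r]. *)

(** * Ideals as predicates and weakly regular sequences *)

Section IdealPredicates.

Variable R : comNzRingType.
Implicit Types (I J : R -> Prop) (f g u : R) (s : seq R).

Definition is_ideal I : Prop :=
  [/\ I 0, forall f g, I f -> I g -> I (f + g) & forall a f, I f -> I (a * f)].

Definition same_ideal I J : Prop := forall f, I f <-> J f.

Definition add_gen I f : R -> Prop := fun g => exists a, I (g - a * f).

Definition colon I u : R -> Prop := fun g => I (u * g).

Definition nonzerodivisor I f : Prop := forall g, I (f * g) -> I g.

(** A regular sequence without the condition that the last quotient is nonzero:
    this weaker property is inherited through exact sequences, and the zero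
    module has it for every sequence. *)
Fixpoint weakly_regular I s : Prop :=
  if s is f :: s' then nonzerodivisor I f /\ weakly_regular (add_gen I f) s'
  else True.

Lemma ideal0 I : is_ideal I -> I 0. Proof. by case. Qed.

Lemma idealD I f g : is_ideal I -> I f -> I g -> I (f + g).
Proof. by case=> _ ID _; apply: ID. Qed.

Lemma idealM I a f : is_ideal I -> I f -> I (a * f).
Proof. by case=> _ _; apply. Qed.

Lemma idealN I f : is_ideal I -> I f -> I (- f).
Proof. by move=> II If; rewrite -mulN1r; apply: idealM. Qed.

Lemma idealB I f g : is_ideal I -> I f -> I g -> I (f - g).
Proof. by move=> II If Ig; apply: idealD => //; apply: idealN. Qed.

Lemma ideal_sum I (T : Type) (r : seq T) (P : pred T) (F : T -> R) :
  is_ideal I -> (forall i, P i -> I (F i)) -> I (\sum_(i <- r | P i) F i).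
Proof.
move=> II IF; apply: big_ind => //; first exact: ideal0.
by move=> f g; apply: idealD.
Qed.

Lemma same_ideal_sym I J : same_ideal I J -> same_ideal J I.
Proof. by move=> IJ f; split=> /IJ. Qed.

Lemma ideal_add_gen I f : is_ideal I -> is_ideal (add_gen I f).
Proof.
move=> II; split.
- by exists 0; rewrite mul0r subr0; apply: ideal0.
- move=> g h [a Ia] [b Ib]; exists (a + b).
  by have := idealD II Ia Ib; congr I; ring.
- move=> c g [a Ia]; exists (c * a).
  by have := idealM c II Ia; congr I; ring.
Qed.

Lemma ideal_add_gens I s : is_ideal I -> is_ideal (foldl add_gen I s).
Proof. by elim: s I => [//|f s IHs] I II; apply/IHs/ideal_add_gen. Qed.

Lemma sub_add_gen I f g : is_ideal I -> I g -> add_gen I f g.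
Proof. by move=> II Ig; exists 0; rewrite mul0r subr0. Qed.

Lemma add_gen_mul I f a : is_ideal I -> add_gen I f (a * f).
Proof. by move=> II; exists a; rewrite subrr; apply: ideal0. Qed.

Lemma add_gen_ext I J f : same_ideal I J -> same_ideal (add_gen I f) (add_gen J f).
Proof. by move=> IJ g; split=> -[a /IJ]; exists a. Qed.

Lemma nonzerodivisor_ext I J f :
  same_ideal I J -> nonzerodivisor I f -> nonzerodivisor J f.
Proof. by move=> IJ If g /IJ/If/IJ. Qed.

Lemma weakly_regular_ext I J s :
  same_ideal I J -> weakly_regular I s -> weakly_regular J s.
Proof.
elim: s I J => [//|f s IHs] I J IJ /= [If Is]; split.
  exact: nonzerodivisor_ext If.
exact: IHs (add_gen_ext f IJ) Is.
Qed.

Lemma add_genC I f g : same_ideal (add_gen (add_gen I f) g) (add_gen (add_gen I g) f).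
Proof.
by move=> h; split=> -[a [b Iab]]; exists b, a; rewrite addrAC.
Qed.

Lemma weakly_regular_rcons I s f :
  weakly_regular I (rcons s f) <->
  weakly_regular I s /\ nonzerodivisor (foldl add_gen I s) f.
Proof.
elim: s I => [|g s IHs] I /=; first by split=> -[].
by rewrite IHs; split=> [[? []]|[[]]].
Qed.

Lemma weakly_regular_cat I s t :
  weakly_regular I (s ++ t) -> weakly_regular I s.
Proof. by elim: s I => [//|f s IHs] I /= [If /IHs]. Qed.

Lemma weakly_regular_unit I s : is_ideal I -> I 1 -> weakly_regular I s.
Proof.
elim: s I => [//|f s IHs] I II I1 /=; split.
  by move=> g _; rewrite -[g]mulr1; apply: idealM.
by apply: IHs; [apply: ideal_add_gen | apply: sub_add_gen].
Qed.

(** The two outer terms of [0 -> R/(I : u) -> R/I -> R/(I, u) -> 0] control the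
    middle one; when [f] is a nonzerodivisor on [R/(I, u)], passing to [R/f]
    keeps this sequence exact, which is what drives the induction. *)
Lemma weakly_regular_colon I u s : is_ideal I ->
  weakly_regular (colon I u) s -> weakly_regular (add_gen I u) s ->
  weakly_regular I s.
Proof.
elim: s I => [//|f s IHs] I II /= [cf cs] [af as_]; split.
  move=> g Ifg.
  have [a Ia] : add_gen I u g by apply/af/sub_add_gen.
  have : colon I u (f * a).
    have := idealB II Ifg (idealM f II Ia).
    by congr I; ring.
  move/cf => Iua; have := idealD II Ia Iua.
  by congr I; ring.
apply: IHs; first exact: ideal_add_gen.
- apply: weakly_regular_ext cs => h; split=> [[a]|[a Ia]].
    rewrite /colon => Ia; exists (u * a); have := Ia.
    by congr I; ring.
  have [b Ib] : add_gen I u a.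
    apply: af; exists h; have := idealN II Ia.
    by congr I; ring.
  exists b; rewrite /colon; have := idealD II Ia (idealM f II Ib).
  by congr I; ring.
- exact: weakly_regular_ext (add_genC _ _ _) as_.
Qed.

Lemma nonzerodivisor_prod I (T : Type) (r : seq T) (P : pred T) (F : T -> R) :
  (forall i, P i -> nonzerodivisor I (F i)) ->
  nonzerodivisor I (\prod_(i <- r | P i) F i).
Proof.
move=> IF; apply: big_ind => //.
  by move=> g; rewrite mul1r.
by move=> f g If Ig h; rewrite -mulrA => /If/Ig.
Qed.

Lemma nonzerodivisor_cong I f g : is_ideal I ->
  I (f - g) -> nonzerodivisor I g -> nonzerodivisor I f.
Proof.
move=> II Ifg Ig h Ifh; apply: Ig.
have := idealB II Ifh (idealM h II Ifg).
by congr I; ring.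
Qed.

End IdealPredicates.

Section Spans.

Variable R : comNzRingType.
Implicit Types (I J A : R -> Prop) (f g u : R) (s : seq R).

Lemma ideal_span_is_ideal A : is_ideal (ideal_span A).
Proof.
split.
- by exists [::]; rewrite big_nil; split.
- move=> f g [s [sA ->]] [t [tA ->]]; exists (s ++ t); rewrite big_cat; split=> // p.
  by rewrite mem_cat => /orP[/sA|/tA].
- move=> a f [s [sA ->]]; exists [seq (a * p.1, p.2) | p <- s]; split.
    by move=> p /mapP[q /sA Aq ->].
  by rewrite big_map mulr_sumr; apply: eq_bigr => p _; rewrite mulrA.
Qed.

Lemma mem_ideal_span A f : A f -> ideal_span A f.
Proof.
move=> Af; exists [:: (1, f)]; rewrite big_seq1 mul1r; split=> // p.
by rewrite inE => /eqP->.
Qed.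

Lemma ideal_span_sub A I f :
  is_ideal I -> (forall g, A g -> I g) -> ideal_span A f -> I f.
Proof.
move=> II AI [s [sA ->]]; rewrite big_seq; apply: ideal_sum => // p /sA/AI.
exact: idealM.
Qed.

Lemma add_seq_nil I : is_ideal I -> same_ideal (ideal_add_seq I [::]) I.
Proof.
move=> II f; split=> [|If].
  by apply: ideal_span_sub => // g [|].
by apply: mem_ideal_span; left.
Qed.

Lemma add_seq_cons I f s : is_ideal I ->
  same_ideal (ideal_add_seq I (f :: s)) (ideal_add_seq (add_gen I f) s).
Proof.
move=> II g; split; apply: ideal_span_sub; try exact: ideal_span_is_ideal.
- move=> h [Ih|]; first by apply: mem_ideal_span; left; apply: sub_add_gen.
  rewrite inE => /orP[/eqP->|hs]; apply: mem_ideal_span; last by right.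
  by left; have := add_gen_mul f 1 II; rewrite mul1r.
- move=> h [[a Ia]|hs]; last by apply: mem_ideal_span; right; rewrite inE hs orbT.
  rewrite -[h](subrK (a * f)); apply: idealD; first exact: ideal_span_is_ideal.
    by apply: mem_ideal_span; left.
  apply: idealM; first exact: ideal_span_is_ideal.
  by apply: mem_ideal_span; right; rewrite inE eqxx.
Qed.

Lemma weakly_regularP I s : is_ideal I ->
  (forall i, (i < size s)%N -> forall g,
     ideal_add_seq I (take i s) (s`_i * g) -> ideal_add_seq I (take i s) g)
  <-> weakly_regular I s.
Proof.
elim: s I => [|f s IHs] I II; first by split.
rewrite /= -IHs; last exact: ideal_add_gen.
split=> [sreg|[If sreg] [|i] i_lt g].
- split=> [g Ifg|i i_lt g /(add_seq_cons f _ II) Ig].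
    by apply/(add_seq_nil II)/(sreg 0 isT g)/(add_seq_nil II).
  by apply/(add_seq_cons f _ II)/(sreg i.+1 i_lt).
- by move=> /(add_seq_nil II)/If/(add_seq_nil II).
- by move=> /(add_seq_cons f _ II) Ig; apply/(add_seq_cons f _ II)/sreg.
Qed.

End Spans.

(** * Truncation by degree and graded ideals *)

Section Truncation.

Variables (K : fieldType) (d : nat).
Local Notation S := {mpoly K[d]}.
Implicit Types (I J : S -> Prop) (f g : S) (s : seq S) (D n : nat).

Definition trunc D f : S := \sum_(n < D) pihomog mdeg n f.

Lemma trunc_is_linear D : linear (trunc D).
Proof.
move=> a f g; rewrite /trunc scaler_sumr -big_split /=.
by apply: eq_bigr => n _; rewrite linearP.
Qed.

HB.instance Definition _ D :=
  GRing.isLinear.Build K S S _ (trunc D) (trunc_is_linear D).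

Lemma trunc_homog D n f :
  f \is n.-homog for mdeg -> trunc D f = if (n < D)%N then f else 0.
Proof.
move=> fn; case: ltnP => nD; rewrite /trunc; last first.
  rewrite big1 // => i _; apply: pihomog_ne0 fn.
  by rewrite neq_ltn (leq_trans (ltn_ord i) nD) orbT.
rewrite (bigD1 (Ordinal nD)) //= pihomog_dE // big1 ?addr0 // => i.
rewrite -val_eqE /= => ne_i; apply: pihomog_ne0 fn.
by rewrite eq_sym.
Qed.

Lemma trunc_id D f : (msize f <= D)%N -> trunc D f = f.
Proof. by move=> fD; rewrite [RHS](pihomog_partitionE fD). Qed.

Lemma truncM D n a f :
  f \is n.-homog for mdeg -> trunc D (a * f) = trunc (D - n) a * f.
Proof.
move=> fn; rewrite [a]mpolyE mulr_suml !linear_sum mulr_suml.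
apply: eq_bigr => m _; rewrite -scalerAl !linearZ /= -scalerAl; congr (_ *: _).
have Xm : ('X_[m] : S) \is (mdeg m).-homog for mdeg by rewrite dhomogX.
rewrite (trunc_homog _ Xm) (trunc_homog _ (dhomogM Xm fn)) ltn_subRL addnC.
by case: ifP => _; rewrite ?mul0r.
Qed.

(** Closure under truncation by degree is a form of homogeneity that passes to
    [add_gen] without having to track individual graded components. *)
Definition graded I : Prop := forall D f, I f -> I (trunc D f).

Definition homogeneous f : Prop := exists n, f \is n.-homog for mdeg.

Lemma graded_add_gen I f : graded I -> homogeneous f -> graded (add_gen I f).
Proof.
move=> gI [n fn] D g [a Ia]; exists (trunc (D - n) a).
by rewrite -truncM // -linearB; apply: gI.
Qed.

Lemma trunc_Xn D i f : trunc D ('X_i ^+ D * f) = 0.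
Proof.
rewrite mulrC mpolyXn (@truncM _ D).
  by rewrite subnn /trunc big_ord0 mul0r.
by rewrite dhomogX /= mdegMn mdeg1 mul1n.
Qed.

(** Graded separatedness: all terms of [X_i ^ t b] have degree at least [t]. *)
Lemma graded_separated I i f : is_ideal I -> graded I ->
  (forall t, exists b, I (f - 'X_i ^+ t * b)) -> I f.
Proof.
move=> II gI /(_ (msize f))[b /(gI (msize f))].
by rewrite linearB /= trunc_Xn subr0 trunc_id.
Qed.

(** If [f g = 0] then [g] is divisible by [x], and the quotient is again killed
    by [f] because [x] is regular; so [g] is divisible by all powers of [x]. *)
Lemma nonzerodivisor_lift I i f : is_ideal I -> graded I ->
  nonzerodivisor I 'X_i -> nonzerodivisor (add_gen I 'X_i) f ->
  nonzerodivisor I f.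
Proof.
move=> II gI Ix If g Ifg; apply: (graded_separated (i := i) II gI) => t.
suff [b [Ib _]] : exists b, I (g - 'X_i ^+ t * b) /\ I (f * b) by exists b.
elim: t => [|t [b [Ib Ifb]]].
  by exists g; rewrite expr0 mul1r subrr; split=> //; apply: ideal0.
have [c Ic] : add_gen I 'X_i b by apply/If/sub_add_gen.
exists c; split.
  have := idealD II Ib (idealM ('X_i ^+ t) II Ic).
  by congr I; rewrite exprS; ring.
apply: Ix; have := idealB II Ifb (idealM f II Ic).
by congr I; ring.
Qed.

(** Moving a variable from the front to the end of a regular sequence is where
    homogeneity is needed: [nonzerodivisor_lift] rests on separatedness of the
    [x]-adic filtration, which graded quotients have. *)
Lemma weakly_regular_swap I i s : is_ideal I -> graded I ->
  (forall f, f \in s -> homogeneous f) ->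
  nonzerodivisor I 'X_i -> weakly_regular (add_gen I 'X_i) s ->
  weakly_regular I s /\ nonzerodivisor (foldl (@add_gen _) I s) 'X_i.
Proof.
elim: s I => [|f s IHs] I II gI s_hom Ix //= [If Is].
have f_hom : homogeneous f by apply: s_hom; rewrite inE eqxx.
have rf := nonzerodivisor_lift II gI Ix If.
have [] // := IHs (add_gen I f).
- exact: ideal_add_gen.
- exact: graded_add_gen.
- by move=> g gs; apply: s_hom; rewrite inE gs orbT.
- move=> g [a Ia].
  have [b Ib] : add_gen I 'X_i a.
    by apply: If; exists g; have := idealN II Ia; congr I; ring.
  exists b; apply: Ix; have := idealD II Ia (idealM f II Ib).
  by congr I; ring.
- exact: weakly_regular_ext (add_genC _ _ _) Is.
Qed.

End Truncation.

(** * Monomial ideals *)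

Section MonomialIdeals.

Variables (K : fieldType) (d : nat).
Local Notation S := {mpoly K[d]}.
Implicit Types (f g : S) (P Q : 'X_{1..d} -> Prop) (i : 'I_d) (Z : {set 'I_d}).

Definition mono_ideal Q f : Prop := forall m, m \in msupp f -> Q m.

Definition upward Q : Prop := forall m n, Q m -> Q (n + m)%MM.

Lemma mono_ideal_mon Q m : mono_ideal Q 'X_[m] <-> Q m.
Proof.
split=> [|Qm n]; first by apply; rewrite msuppX inE.
by rewrite msuppX inE => /eqP->.
Qed.

Lemma mono_ideal_ext P Q :
  (forall m, P m <-> Q m) -> same_ideal (mono_ideal P) (mono_ideal Q).
Proof. by move=> PQ f; split=> fI m /fI/PQ. Qed.

Lemma mono_idealMX Q f n :
  mono_ideal Q ('X_[n] * f) <-> mono_ideal (fun m => Q (n + m)%MM) f.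
Proof.
rewrite mulrC /mono_ideal; split=> fQ m mf.
  apply: fQ; rewrite (perm_mem (msuppMX _ _)); exact: map_f.
by move: mf; rewrite (perm_mem (msuppMX _ _)) => /mapP[m' /fQ ? ->].
Qed.

Lemma mono_ideal_is_ideal Q : upward Q -> is_ideal (mono_ideal Q).
Proof.
move=> upQ.
have QD f g : mono_ideal Q f -> mono_ideal Q g -> mono_ideal Q (f + g).
  move=> fQ gQ m /msuppD_le; rewrite mem_cat => /orP[/fQ|/gQ] //.
have Q0 : mono_ideal Q 0 by move=> m; rewrite msupp0.
split=> // a f fQ; rewrite [a]mpolyE mulr_suml.
apply: big_ind => //= m _; rewrite -scalerAl => n /msuppZ_le.
have : mono_ideal Q ('X_[m] * f) by apply/mono_idealMX => k /fQ/upQ.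
exact.
Qed.

Lemma graded_mono_ideal Q : graded (mono_ideal Q).
Proof.
move=> D f fQ; rewrite [f]mpolyE linear_sum big_seq => m.
move/msupp_sum_le => /flatten_mapP[n]; rewrite mem_filter => /andP[nf _].
rewrite linearZ /= => /msuppZ_le.
have Xn : ('X_[n] : S) \is (mdeg n).-homog for mdeg by rewrite dhomogX.
rewrite (trunc_homog _ Xn); case: ifP => _; last by rewrite msupp0.
by rewrite msuppX inE => /eqP->; apply: fQ.
Qed.

Lemma colon_mono_ideal Q i :
  same_ideal (colon (mono_ideal Q) 'X_i)
             (mono_ideal (fun m => Q (U_(i) + m)%MM)).
Proof. by move=> f; apply: mono_idealMX. Qed.

Lemma add_gen_mono_ideal Q i : upward Q ->
  same_ideal (add_gen (mono_ideal Q) 'X_i)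
             (mono_ideal (fun m => Q m \/ (0 < m i)%N)).
Proof.
move=> upQ f; set Q' := fun m => _.
have upQ' : upward Q'.
  move=> m n [/upQ Qm|mi]; [by left | right].
  by rewrite mnmDE ltn_addl.
have II' : is_ideal (mono_ideal Q') by apply: mono_ideal_is_ideal.
split=> [[a fa]|fQ].
  rewrite -[f](subrK (a * 'X_i)); apply: (idealD II').
    by move=> m /fa; left.
  apply: (idealM _ II').
  by apply/mono_ideal_mon; right; rewrite mnm1E eqxx.
have aI := ideal_add_gen 'X_i (mono_ideal_is_ideal upQ).
rewrite [f]mpolyE big_seq; apply: ideal_sum => // m /fQ Qm.
rewrite -mul_mpolyC; apply: (idealM _ aI).
case: Qm => [Qm|mi].
  by apply: sub_add_gen; [apply: mono_ideal_is_ideal | apply/mono_ideal_mon].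
have -> : m = (m - U_(i) + U_(i))%MM.
  rewrite submK //; apply/mnm_lepP => j; rewrite mnm1E.
  by case: eqP => // <-.
by rewrite mpolyXD; apply: add_gen_mul; apply: mono_ideal_is_ideal.
Qed.

End MonomialIdeals.

(** * Elementary symmetric polynomials on coordinate subspaces *)

Section ElementarySymmetric.

Variables (K : fieldType) (d : nat).
Local Notation S := {mpoly K[d]}.
Implicit Types (f g : S) (i : 'I_d) (Z : {set 'I_d}).

Definition meets Z (m : 'X_{1..d}) : Prop := exists2 z, z \in Z & (0 < m z)%N.

Definition coord_ideal Z : S -> Prop := mono_ideal (meets Z).

Definition mesyms n : seq S := [seq mesym d K k.+1 | k <- iota 0 n].

Lemma upward_meets Z : upward (meets Z).
Proof. by move=> m n [z Zz mz]; exists z => //; rewrite mnmDE ltn_addl. Qed.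

Lemma coord_ideal_is_ideal Z : is_ideal (coord_ideal Z).
Proof. exact/mono_ideal_is_ideal/upward_meets. Qed.

Lemma coord_idealX Z z : z \in Z -> coord_ideal Z 'X_z.
Proof. by move=> Zz; apply/mono_ideal_mon; exists z => //; rewrite mnm1E eqxx. Qed.

Lemma add_gen_coord_ideal Z i :
  same_ideal (add_gen (coord_ideal Z) 'X_i) (coord_ideal (i |: Z)).
Proof.
move=> f; rewrite (add_gen_mono_ideal i (@upward_meets Z)).
apply: mono_ideal_ext => m; split=> [[[z Zz mz]|mi]|[z]].
- by exists z => //; rewrite setU1r.
- by exists i; rewrite ?setU11.
- by rewrite in_setU1 => /predU1P[->|Zz] mz; [right | left; exists z].
Qed.

Lemma nonzerodivisor_coord Z i :
  i \notin Z -> nonzerodivisor (coord_ideal Z) 'X_i.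
Proof.
move=> iZ f /mono_idealMX fZ m /fZ[z Zz]; rewrite mnmDE mnm1E.
by case: eqP iZ => [->|_ _]; [rewrite Zz | exists z].
Qed.

(** A set of variables of the size of the complement of [Z], other than this
    complement, meets [Z]. *)
Lemma mesym_coord_top Z :
  coord_ideal Z (mesym d K #|~: Z| - \prod_(i in ~: Z) 'X_i).
Proof.
rewrite /mesym (bigD1 (~: Z)) //= addrAC subrr add0r.
have ZI := coord_ideal_is_ideal Z.
apply: ideal_sum => // h /andP[/eqP hZ h_ne].
have /subsetPn[z hz] : ~~ (h \subset ~: Z).
  by apply: contra h_ne => hsub; rewrite eqEcard hsub hZ /=.
rewrite in_setC negbK => Zz; rewrite (bigD1 z) //= mulrC.
by apply: (idealM _ ZI); apply: coord_idealX.
Qed.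

Lemma mesymsS n : mesyms n.+1 = rcons (mesyms n) (mesym d K n.+1).
Proof. by rewrite /mesyms -[n.+1]addn1 iotaD map_cat /= cats1 add0n addn1. Qed.

Lemma mesyms_cat n m : (m <= n)%N -> exists s, mesyms n = mesyms m ++ s.
Proof.
move=> /subnKC <-; rewrite /mesyms iotaD map_cat.
by exists [seq mesym d K k.+1 | k <- iota (0 + m) (n - m)].
Qed.

Lemma homogeneous_mesyms n f : f \in mesyms n -> homogeneous f.
Proof. by case/mapP=> i _ ->; exists i.+1; apply: dhomog_mesym. Qed.

(** Elementary symmetric polynomials restrict to elementary symmetric
    polynomials on every coordinate subspace, so a single sequence serves all
    quotients by variables, over any field.  In [n] variables, setting one of
    them to zero and swapping shows that [e_1, ..., e_(n-1)] is regular and that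
    every variable stays a nonzerodivisor after it; hence so is their product
    [e_n]. *)
Lemma weakly_regular_mesyms Z : weakly_regular (coord_ideal Z) (mesyms #|~: Z|).
Proof.
move nZ: #|~: Z| => n; elim: n Z nZ => [//|n IHn] Z nZ.
have ZI := coord_ideal_is_ideal Z.
have swap i : i \notin Z -> weakly_regular (coord_ideal Z) (mesyms n) /\
    nonzerodivisor (foldl (@add_gen _) (coord_ideal Z) (mesyms n)) 'X_i.
  move=> iZ; apply: weakly_regular_swap => //.
  - exact: graded_mono_ideal.
  - exact: homogeneous_mesyms.
  - exact: nonzerodivisor_coord.
  apply: weakly_regular_ext (same_ideal_sym (add_gen_coord_ideal Z i)) _.
  apply: IHn; have := cardsD1 i (~: Z); rewrite nZ in_setC iZ add1n => -[->].
  by congr #|pred_of_set _|; apply/setP=> j; rewrite !inE negb_or.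
rewrite mesymsS; apply/weakly_regular_rcons; split.
  have /card_gt0P[i] : (0 < #|~: Z|)%N by rewrite nZ.
  by rewrite in_setC => /swap[].
have sub : coord_ideal Z (mesym d K n.+1 - \prod_(i in ~: Z) 'X_i).
  by rewrite -nZ; apply: mesym_coord_top.
apply: (@nonzerodivisor_cong _ _ _ (\prod_(i in ~: Z) 'X_i)).
- exact: ideal_add_gens.
- elim: (mesyms n) (coord_ideal Z) ZI sub => [//|f s IHs] I II Ie /=.
  by apply: IHs; [apply: ideal_add_gen | apply: sub_add_gen].
- by apply: nonzerodivisor_prod => i; rewrite in_setC => /swap[].
Qed.

Lemma weakly_regular_mesyms_le Z n : (n <= #|~: Z|)%N ->
  weakly_regular (coord_ideal Z) (mesyms n).
Proof.
case/mesyms_cat=> s def_s; apply: (@weakly_regular_cat _ _ _ s).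
by rewrite -def_s; apply: weakly_regular_mesyms.
Qed.

End ElementarySymmetric.

(** * Ordered matchings as lists of pairs *)

Section OrderedPairs.

Variables (T : finType) (e : rel T).
Hypotheses (e_sym : ssrbool.symmetric e) (e_irr : irreflexive e).
Implicit Types (p q : T * T) (s : seq (T * T)).

(** The list is in the order of the edges of an ordered matching, so that adding
    a pair at the head only asks that its vertices avoid the neighbours of the
    first vertices already present. *)
Definition ordered_pairs s : bool :=
  all (fun p => e p.1 p.2) s &&
  pairwise (fun p q => ~~ e q.1 p.1 && ~~ e q.1 p.2) s.

Lemma disjoint_pairs_of_ordered p q : e p.1 p.2 -> e q.1 q.2 ->
  ~~ e q.1 p.1 -> ~~ e q.1 p.2 ->
  [disjoint [set p.1; p.2] & [set q.1; q.2]].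
Proof.
move=> ep eq q1p1 q1p2; apply/pred0P=> x /=; rewrite !inE; apply/negP.
case/andP=> /orP[]/eqP-> /orP[]/eqP def.
- by move: q1p2; rewrite -def ep.
- by move: q1p1; rewrite def eq.
- by move: q1p1; rewrite -def e_sym ep.
- by move: q1p2; rewrite def eq.
Qed.

(** No vertex of a pair is adjacent to the first vertex of a later pair; as that
    vertex is adjacent to its own partner, this makes the edges disjoint. *)
Lemma ordered_pairs_leq s : ordered_pairs s -> (size s <= ord_match e)%N.
Proof.
case: s => [//|p0 s0]; set s := p0 :: s0; case/andP=> /allP es /(pairwiseP p0) ord.
pose E (i : nat) := [set (nth p0 s i).1; (nth p0 s i).2].
have eE (i : 'I_(size s)) : e (nth p0 s i).1 (nth p0 s i).2.
  exact/es/mem_nth.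
have disj (i j : 'I_(size s)) : i != j -> [disjoint E i & E j].
  rewrite neq_ltn => /orP[] lt_ij; last rewrite disjoint_sym.
    have /andP[] := ord i j (ltn_ord i) (ltn_ord j) lt_ij.
    exact: disjoint_pairs_of_ordered.
  have /andP[] := ord j i (ltn_ord j) (ltn_ord i) lt_ij.
  exact: disjoint_pairs_of_ordered.
have E_inj : injective (fun i : 'I_(size s) => E i).
  move=> i j Eij; apply/eqP; apply: contraT => /disj/pred0P/(_ (nth p0 s i).1) /=.
  by rewrite -Eij /E !inE eqxx.
pose M := [set E i | i : 'I_(size s)].
have cM : #|M| = size s by rewrite card_imset // card_ord.
rewrite -cM; apply: leq_bigmax_cond; apply/andP; split.
  apply/andP; split.
    apply/subsetP=> A /imsetP[i _ ->]; apply/imsetP.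
    by exists (nth p0 s i); rewrite ?inE ?eE.
  apply/trivIsetP=> A B /imsetP[i _ ->] /imsetP[j _ ->] ne.
  by apply: disj; apply: contraNneq ne => ->.
apply/existsP; exists [ffun i : 'I_#|M| => (nth p0 s i).1].
apply/existsP; exists [ffun i : 'I_#|M| => (nth p0 s i).2].
have lt_s (i : 'I_#|M|) : (i < size s)%N by rewrite -cM.
apply/and3P; split.
- apply/eqP/setP=> A; apply/imsetP/imsetP=> -[i _ ->].
    by exists (cast_ord (esym cM) i) => //; rewrite !ffunE.
  by exists (cast_ord cM i) => //; rewrite !ffunE.
- apply/forallP=> i; apply/forallP=> j; rewrite !ffunE.
  have [lt_ij|lt_ji|->] := ltngtP i j; last by rewrite e_irr.
    by rewrite e_sym; have /andP[] := ord i j (lt_s i) (lt_s j) lt_ij.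
  by have /andP[] := ord j i (lt_s j) (lt_s i) lt_ji.
- apply/forallP=> i; apply/forallP=> j; rewrite !ffunE; apply/implyP.
  apply: contraLR; rewrite -ltnNge => lt_ji.
  by have /andP[] := ord j i (lt_s j) (lt_s i) lt_ji.
Qed.

End OrderedPairs.

(** * The branching argument for the lower bound *)

Section LowerBound.

Variables (K : fieldType) (d : nat) (e : rel 'I_d) (k : nat).
Hypotheses (e_sym : ssrbool.symmetric e) (e_irr : irreflexive e).
Implicit Types (a m : 'X_{1..d}) (Z : {set 'I_d}) (x y v w : 'I_d).
Implicit Types (s : seq ('I_d * 'I_d)).

Definition edge_bound a m : Prop :=
  forall x y, e x y -> (k <= a x + m x + (a y + m y))%N.

(** Generated by the variables in [Z] and the colon ideal [(I : x^a)], where [I]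
    consists of the polynomials of order at least [k] at every edge. *)
Definition state_ideal a Z : {mpoly K[d]} -> Prop :=
  mono_ideal (fun m => meets Z m \/ edge_bound a m).

(** Live vertices are the non-isolated ones of the graph of edges [(v, w)] with
    [a v + a w < k], whose cover ideal is the radical of the colon ideal. *)
Definition live a v : bool := [exists w, e v w && (a v + a w < k)%N].

Lemma upward_edge_bound a : upward (edge_bound a).
Proof. by move=> m n am x y /am; rewrite !mnmDE; lia. Qed.

Lemma upward_state a Z : upward (fun m => meets Z m \/ edge_bound a m).
Proof.
by move=> m n [/upward_meets|/upward_edge_bound] Qm; [left | right]; apply: Qm.
Qed.

Lemma state_ideal_is_ideal a Z : is_ideal (state_ideal a Z).
Proof. exact/mono_ideal_is_ideal/upward_state. Qed.

Lemma live_ends a v w : e v w -> (a v + a w < k)%N -> live a v /\ live a w.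
Proof.
move=> vw lt_k; split; apply/existsP; first by exists w; rewrite vw.
by exists v; rewrite e_sym vw addnC.
Qed.

Lemma live_add a v w : live (a + U_(v))%MM w -> live a w.
Proof.
case/existsP=> u /andP[wu]; rewrite !mnmDE => lt_k.
by apply/existsP; exists u; rewrite wu; lia.
Qed.

Variable n : nat.

Definition state_regular a Z : Prop :=
  weakly_regular (state_ideal a Z) (mesyms K d n).

Lemma state_regular_branch a Z x : x \notin Z ->
  state_regular (a + U_(x))%MM Z -> state_regular a (x |: Z) ->
  state_regular a Z.
Proof.
move=> xZ reg_colon reg_add; apply: (weakly_regular_colon (u := 'X_x)).
- exact: state_ideal_is_ideal.
- apply: weakly_regular_ext reg_colon; apply: same_ideal_sym => f.
  rewrite (colon_mono_ideal _ x); apply: mono_ideal_ext => m.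
  have -> : edge_bound a (U_(x) + m)%MM <-> edge_bound (a + U_(x))%MM m.
    by split=> bd u v /bd; rewrite !mnmDE; lia.
  suff -> : meets Z (U_(x) + m)%MM <-> meets Z m by [].
  split=> -[z Zz mz]; exists z => //; last by rewrite mnmDE ltn_addl.
  by move: mz xZ; rewrite mnmDE mnm1E; case: eqP => // ->; rewrite Zz.
- apply: weakly_regular_ext reg_add; apply: same_ideal_sym => f.
  rewrite (add_gen_mono_ideal x (@upward_state a Z)); apply: mono_ideal_ext => m.
  split=> [[[[z Zz mz]|bd]|mx]|[[z]|bd]].
  + by left; exists z; rewrite ?setU1r.
  + by right.
  + by left; exists x; rewrite ?setU11.
  + by rewrite in_setU1 => /predU1P[->|Zz] mz; [right | left; left; exists z].
  + by left; right.
Qed.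

(** Both ends of an edge whose bound fails are set to zero, so every monomial in
    the other variables violates that bound: only the variables remain. *)
Lemma state_regular_leaf a Z x y : x \in Z -> y \in Z -> e x y ->
  (a x + a y < k)%N -> (n + #|Z| <= d)%N -> state_regular a Z.
Proof.
move=> Zx Zy exy lt_k leZ.
have coordE : same_ideal (coord_ideal Z) (state_ideal a Z).
  apply: mono_ideal_ext => m; split=> [?|[//|/(_ x y exy)]]; first by left.
  case: (posnP (m x)) => [-> |mx _]; last by exists x.
  case: (posnP (m y)) => [-> |my _]; last by exists y.
  by rewrite !addn0 leqNgt lt_k.
apply: (weakly_regular_ext coordE); apply: weakly_regular_mesyms_le.
by have := cardsC Z; rewrite card_ord; lia.
Qed.

Lemma state_regular_dead a Z : (forall v, ~~ live a v) -> state_regular a Z.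
Proof.
move=> dead; rewrite /state_regular; apply: weakly_regular_unit.
  exact: state_ideal_is_ideal.
rewrite -mpolyX0; apply/mono_ideal_mon; right=> x y exy; rewrite !mnm0E !addn0.
by rewrite leqNgt; apply: contra (dead x) => lt_k; case: (live_ends exy lt_k).
Qed.

Definition avoids_live a s : Prop :=
  forall p, p \in s -> forall v, live a v -> ~~ e p.1 v.

Definition firsts s : {set 'I_d} := [set x in map fst s].

Lemma firsts_cons p s : firsts (p :: s) = p.1 |: firsts s.
Proof. by apply/setP=> x; rewrite !inE. Qed.

Lemma card_firsts s : (#|firsts s| <= size s)%N.
Proof. by rewrite cardsE -(size_map fst); apply: card_size. Qed.

Lemma avoids_live_add a v s : avoids_live a s -> avoids_live (a + U_(v))%MM s.
Proof. by move=> av p /av avp w /live_add/avp. Qed.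

Lemma avoids_live_notin a s x : avoids_live a s -> live a x -> x \notin firsts s.
Proof.
move=> av /existsP[y /andP[xy lt_k]].
have [_ ly] := live_ends xy lt_k.
by apply/negP; rewrite inE => /mapP[p /av/(_ y ly) py def_x]; rewrite -def_x xy in py.
Qed.

Definition slack a := (\sum_v (k - a v))%N.

Lemma slack_add a v : live a v -> (slack (a + U_(v))%MM < slack a)%N.
Proof.
case/existsP=> w /andP[_ lt_k]; rewrite /slack (bigD1 v) //= [ltnRHS](bigD1 v) //=.
rewrite mnmDE mnm1E eqxx -addSn leq_add //; first by lia.
by apply: leq_sum => u _; rewrite mnmDE; lia.
Qed.

Hypothesis n_bound : forall s, ordered_pairs e s -> (size s + n < d)%N.

(** [x] has just been set to zero and has a live neighbour [v].  Either [v] is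
    set to zero too, which is a leaf with at most [size s + 2] variables killed,
    or the exponent at [v] grows, which makes the edge [(x, v)] closer to being
    satisfied and keeps [x] minimal. *)
Lemma state_regular_pair a s x y v :
  (forall w, live a w -> forall s x y,
    avoids_live (a + U_(w))%MM s -> ordered_pairs e ((x, y) :: s) ->
    (forall u, live (a + U_(w))%MM u ->
       ((a + U_(w))%MM x <= (a + U_(w))%MM u)%N) ->
    state_regular (a + U_(w))%MM (x |: firsts s)) ->
  avoids_live a s -> ordered_pairs e ((x, y) :: s) ->
  (forall u, live a u -> (a x <= a u)%N) ->
  e x v -> (a x + a v < k)%N -> state_regular a (x |: firsts s).
Proof.
move=> IH av ord_s minx xv lt_k; have [lx lv] := live_ends xv lt_k.
have xvF : (x == v) = false by apply/eqP=> xv'; rewrite xv' e_irr in xv.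
apply: (@state_regular_branch a _ v).
- by rewrite in_setU1 negb_or eq_sym xvF /= (avoids_live_notin av).
- apply: (IH v lv _ _ y) => // [|u lu]; first exact: avoids_live_add.
  rewrite !mnmDE !mnm1E [v == x]eq_sym xvF addn0.
  exact: leq_trans (minx u (live_add lu)) (leq_addr _ _).
- apply: (@state_regular_leaf _ _ x v) => //; rewrite ?inE ?eqxx ?orbT //.
  rewrite !cardsU1; have := n_bound ord_s; have := card_firsts s.
  move: (leq_b1 (v \notin x |: firsts s)) (leq_b1 (x \notin firsts s)) => /=.
  move: (nat_of_bool _) (nat_of_bool _) (#|_|); lia.
Qed.

(** Branch on a live vertex [x] of minimal exponent.  When [x] has been set to
    zero and has no live neighbour left, no live vertex [v] is adjacent to [x] at
    all: the edge would satisfy [k <= a x + a v], while [v] has a live neighbour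
    [w] with [a v + a w < k], so [a w < a x] against minimality.  Hence all pairs
    chosen afterwards avoid the neighbours of [x], and the list [s] of chosen
    pairs stays an ordered matching.  The second half of the induction statement
    treats the phase in which [x] still may have live neighbours. *)
Lemma state_regular_avoiding a s :
  avoids_live a s -> ordered_pairs e s -> state_regular a (firsts s).
Proof.
suff: (forall s, avoids_live a s -> ordered_pairs e s ->
         state_regular a (firsts s)) /\
      (forall s x y, avoids_live a s -> ordered_pairs e ((x, y) :: s) ->
         (forall u, live a u -> (a x <= a u)%N) ->
         state_regular a (x |: firsts s)).
  by case=> + _; apply.
move: s => _; have [N] := ubnP (slack a); elim: N a => [//|N IHN] a lt_N.
have IH w : live a w -> _ := fun lw =>
  IHN (a + U_(w))%MM (leq_trans (slack_add lw) lt_N).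
have stepA s : avoids_live a s -> ordered_pairs e s -> state_regular a (firsts s).
  move=> av ord_s; case: (pickP (live a)) => [x0 lx0|dead]; last first.
    by apply: state_regular_dead => v; rewrite dead.
  case: (arg_minnP (fun v => a v) lx0) => x lx minx.
  have /existsP[y /andP[xy lt_k]] := lx; have [_ ly] := live_ends xy lt_k.
  apply: (@state_regular_branch a _ x); first exact: (avoids_live_notin av).
    by have [+ _] := IH x lx; apply => //; apply: avoids_live_add.
  apply: (@state_regular_pair _ _ _ y y) => //.
    by move=> w /IH[].
  case/andP: ord_s => es ps; rewrite /ordered_pairs /= xy es ps !andbT /=.
  by apply/allP=> p ps' /=; rewrite !(av p ps').
split=> // s x y av ord_s minx.
have [/existsP[v /andP[xv lt_k]]|no_v] := boolP (live a x).
  by apply: (@state_regular_pair _ _ _ y v) => // w /IH[].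
rewrite -[x]/((x, y).1) -firsts_cons; apply: stepA => // p.
rewrite inE => /predU1P[->|/av //] v lv /=; apply/negP=> xv.
have /existsP[w /andP[vw lt_k]] := lv; have [_ lw] := live_ends vw lt_k.
have := minx w lw; move/existsPn/(_ v): no_v; rewrite xv /= -leqNgt; lia.
Qed.

End LowerBound.

(** * Powers of the cover ideal of a bipartite graph *)

Section CoverIdealPowers.

Variables (K : fieldType) (d : nat) (e : rel 'I_d).
Local Notation S := {mpoly K[d]}.
Implicit Types (f g : S) (m n : 'X_{1..d}) (P Q : 'X_{1..d} -> Prop).

Definition order_ideal k : S -> Prop := mono_ideal (edge_bound e k 0%MM).

Lemma order_ideal_is_ideal k : is_ideal (order_ideal k).
Proof. exact/mono_ideal_is_ideal/upward_edge_bound. Qed.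

Lemma mono_ideal_sub P I f : is_ideal I ->
  (forall m, P m -> I 'X_[m]) -> mono_ideal P f -> I f.
Proof.
move=> II PI fP; rewrite [f]mpolyE big_seq; apply: ideal_sum => // m /fP/PI Im.
by rewrite -mul_mpolyC; apply: (idealM _ II).
Qed.

Lemma mono_idealM P Q R f g : (forall m n, P m -> Q n -> R (m + n)%MM) ->
  mono_ideal P f -> mono_ideal Q g -> mono_ideal R (f * g).
Proof.
move=> PQR fP gQ m /msuppM_le /allpairsP[[m1 m2] [/= /fP Pm /gQ Qm ->]].
exact: PQR.
Qed.

Lemma cover_idealE : same_ideal (@cover_ideal K d e) (order_ideal 1).
Proof.
move=> f; split=> [fJ m mf i j ij|fI i j ij].
  have : mono_ideal (fun m => 0 < m i + m j)%N f.
    apply: ideal_span_sub (fJ i j ij).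
      by apply: mono_ideal_is_ideal => m1 n1; rewrite !mnmDE; lia.
    by move=> g [] ->; apply/mono_ideal_mon; rewrite !mnm1E eqxx; lia.
  by move/(_ m mf); rewrite !mnm0E.
have II := ideal_span_is_ideal (fun g : S => g = 'X_i \/ g = 'X_j).
apply: (mono_ideal_sub II _ fI) => m /(_ i j ij); rewrite !mnm0E !add0n addn_gt0.
have IX v : 'X_v = 'X_i :> S \/ 'X_v = 'X_j :> S -> (0 < m v)%N ->
    ideal_span (fun g : S => g = 'X_i \/ g = 'X_j) 'X_[m].
  move=> vij mv; have -> : m = (m - U_(v) + U_(v))%MM.
    rewrite submK //; apply/mnm_lepP => u; rewrite mnm1E.
    by case: eqP => // <-.
  by rewrite mpolyXD; apply: (idealM _ II); apply: mem_ideal_span.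
by case/orP; apply: IX; [left | right].
Qed.

Lemma prod_order_ideal (t : seq S) :
  (forall g, g \in t -> order_ideal 1 g) -> order_ideal (size t) (\prod_(g <- t) g).
Proof.
elim: t => [_|g t IHt tJ]; first by rewrite big_nil => m _ i j _.
rewrite big_cons; apply: mono_idealM (tJ g _) (IHt _); last 1 first.
- by move=> h ht; apply: tJ; rewrite inE ht orbT.
- move=> m n mJ nJ i j ij; move: (mJ i j ij) (nJ i j ij).
  by rewrite !mnmDE !mnm0E /=; lia.
- by rewrite inE eqxx.
Qed.

Lemma sum_ltn_indicator k c : (\sum_(t < k) (t < c)%N <= c)%N.
Proof.
suff -> : (\sum_(t < k) (t < c)%N = minn k c)%N by rewrite geq_minr.
by elim: k => [|k IHk]; [rewrite big_ord0 min0n | rewrite big_ord_recr /= IHk; lia].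
Qed.

Lemma sum_geq_indicator k c : (\sum_(t < k) (k <= c + t)%N <= c)%N.
Proof.
have sumE j : (\sum_(t < j) (k <= c + t)%N = j - (k - c))%N.
  by elim: j => [|j IHj]; [rewrite big_ord0 | rewrite big_ord_recr /= IHj; lia].
by rewrite sumE; lia.
Qed.

(** A monomial of order at least [k] at every edge of a bipartite graph is
    divisible by a product of [k] vertex covers: the [t]-th one takes, on one
    side, the vertices of exponent more than [t], and on the other side those of
    exponent at least [k - t]. *)
Lemma ideal_pow_cover k : bipartite e ->
  same_ideal (ideal_pow (@cover_ideal K d e) k) (order_ideal k).
Proof.
case=> A bipA f; split.
  apply: ideal_span_sub; first exact: order_ideal_is_ideal.
  move=> _ [t [tJ ->]]; rewrite -[k in order_ideal k](size_tuple t).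
  by apply: prod_order_ideal => g /tJ/cover_idealE.
have II := ideal_span_is_ideal (fun f => exists t : k.-tuple S,
  (forall g, g \in t -> @cover_ideal K d e g) /\ f = \prod_(g <- t) g).
apply: (mono_ideal_sub II) => m m_k.
pose C (t : nat) : 'X_{1..d} :=
  [multinom (if i \in A then t < m i else k <= m i + t)%N : nat | i < d].
have leC : (\sum_(t < k) C t <= m)%MM.
  apply/mnm_lepP=> i; rewrite mnm_sumE.
  under eq_bigr do rewrite mnmE.
  by case: (i \in A); [apply: sum_ltn_indicator | apply: sum_geq_indicator].
rewrite -(submK leC) mpolyXD; apply: (idealM _ II); apply: mem_ideal_span.
exists [tuple 'X_[C t] | t < k]; split; last first.
  rewrite big_tuple (big_morph _ (@mpolyXD _ _) (@mpolyX0 _ _)).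
  by apply: eq_bigr => t _; rewrite tnth_mktuple.
move=> _ /mapP[t _ ->]; apply/cover_idealE/mono_ideal_mon => i j ij.
move: (bipA i j ij) (m_k i j ij); rewrite !mnmE.
by case: (i \in A); case: (j \in A) => //= _; lia.
Qed.

End CoverIdealPowers.

(** * The Koszul complex and regular sequences *)

Section Koszul.

Variable R : comNzRingType.
Implicit Types (I P : R -> Prop) (f g x : R) (s xs : seq R).
Implicit Types (b c : bitseq) (u v w y z : bitseq -> R) (i j p : nat).

(** A chain assigns a coefficient to each bit sequence of the length of [xs],
    seen as a subset of [xs].  The recursion presents the complex on [x :: xs] as
    the mapping cone of [x] on the complex on [xs], a chain being a pair [(u, v)]
    that stands for [u + e_x v]; all signs come from this. *)
Fixpoint koszul_d xs z b : R :=
  match xs, b with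
  | x :: xs', false :: b' =>
      koszul_d xs' (fun c => z (false :: c)) b' + x * z (true :: b')
  | _ :: xs', true :: b' => - koszul_d xs' (fun c => z (true :: c)) b'
  | _, _ => 0
  end.

(** Exterior multiplication by the [p]-th basis vector. *)
Fixpoint wedge p z b : R :=
  match p, b with
  | 0, true :: b' => z (false :: b')
  | p'.+1, true :: b' => - wedge p' (fun c => z (true :: c)) b'
  | p'.+1, false :: b' => wedge p' (fun c => z (false :: c)) b'
  | _, _ => 0
  end.

(** The value of the differential at [b] is a signed sum of terms [x_j z (b + j)];
    this lets membership, vanishing and coefficients be read off termwise without
    naming the signs. *)
Lemma koszul_d_closed P xs z b :
  P 0 -> (forall f g, P f -> P g -> P (f + g)) -> (forall f, P f -> P (- f)) ->
  size b = size xs ->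
  (forall j, (j < size xs)%N -> nth false b j = false ->
     P (xs`_j * z (set_nth false b j true))) ->
  P (koszul_d xs z b).
Proof.
move=> P0 PD PN; elim: xs b z => [//|x xs IHs] [//|[] b] z [sz] Pz /=.
  by apply: PN; apply: IHs => // j j_lt; apply: (Pz j.+1).
apply: PD; last exact: (Pz 0).
by apply: IHs => // j j_lt; apply: (Pz j.+1).
Qed.

Lemma wedge_closed P p z b :
  P 0 -> (forall f, P f -> P (- f)) -> (p < size b)%N ->
  (nth false b p -> P (z (set_nth false b p false))) -> P (wedge p z b).
Proof.
move=> P0 PN; elim: p b z => [|p IHp] [//|[] b] z //= p_lt Pz.
- exact: Pz.
- by apply: PN; apply: IHp.
- exact: IHp.
Qed.

Lemma eq_koszul_d xs y z b : y =1 z -> koszul_d xs y b = koszul_d xs z b.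
Proof.
elim: xs b y z => [//|x xs IHs] [//|[] b] y z yz /=; last rewrite yz.
  by congr (- _); apply: IHs => c; apply: yz.
by congr (_ + _); apply: IHs => c; apply: yz.
Qed.

Lemma koszul_dDZ xs y z f b :
  koszul_d xs (fun c => y c + f * z c) b = koszul_d xs y b + f * koszul_d xs z b.
Proof.
elim: xs b y z => [|x xs IHs] [|[] b] y z /=; try by rewrite mulr0 addr0.
  by rewrite (IHs b (fun c => y (true :: c)) (fun c => z (true :: c))); ring.
by rewrite (IHs b (fun c => y (false :: c)) (fun c => z (false :: c))); ring.
Qed.

Lemma koszul_d0 xs b : koszul_d xs (fun=> 0) b = 0.
Proof. by elim: xs b => [//|x xs IHs] [//|[] b] /=; rewrite IHs ?oppr0 ?mulr0 ?addr0. Qed.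

Lemma koszul_dZ xs z f b : koszul_d xs (fun c => f * z c) b = f * koszul_d xs z b.
Proof.
rewrite -[RHS]add0r -[X in X + _](koszul_d0 xs b) -koszul_dDZ.
by apply: eq_koszul_d => c; rewrite add0r.
Qed.

Lemma koszul_dN xs z b : koszul_d xs (fun c => - z c) b = - koszul_d xs z b.
Proof. by rewrite -mulN1r -koszul_dZ; apply: eq_koszul_d => c; rewrite mulN1r. Qed.

Lemma koszul_dB xs y z b :
  koszul_d xs (fun c => y c - z c) b = koszul_d xs y b - koszul_d xs z b.
Proof.
by rewrite -mulN1r -koszul_dDZ; apply: eq_koszul_d => c; rewrite mulN1r.
Qed.

Lemma koszul_dd xs z b : koszul_d xs (koszul_d xs z) b = 0.
Proof.
elim: xs b z => [//|x xs IHs] [//|[] b] z /=.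
  by rewrite koszul_dN IHs !oppr0.
by rewrite koszul_dDZ IHs add0r mulrN subrr.
Qed.

Lemma wedgeDZ p y z f b :
  wedge p (fun c => y c + f * z c) b = wedge p y b + f * wedge p z b.
Proof.
elim: p b y z => [|p IHp] [|[] b] y z /=; try by rewrite ?mulr0 ?addr0.
by rewrite (IHp b (fun c => y (true :: c)) (fun c => z (true :: c))); ring.
Qed.

Lemma wedgeN p z b : wedge p (fun c => - z c) b = - wedge p z b.
Proof.
elim: p b z => [|p IHp] [|[] b] z /=; rewrite ?oppr0 //; first by congr (- _).
Qed.

Lemma koszul_homotopy xs p z b : (p < size xs)%N -> size b = size xs ->
  koszul_d xs (wedge p z) b + wedge p (koszul_d xs z) b = xs`_p * z b.
Proof.
elim: xs p b z => [//|x xs IHs] [|p] [//|[] b] z //= p_lt [sz].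
- by rewrite addrA addNr add0r.
- by rewrite koszul_d0 add0r addr0.
- rewrite koszul_dN wedgeN !opprK; exact: IHs.
- rewrite wedgeDZ mulrN -addrA [- _ + _]addrC -addrA subrr addr0; exact: IHs.
Qed.

Definition low_vanishing xs i z : Prop :=
  forall b, size b = size xs -> (count id b < i)%N -> z b = 0.

Definition koszul_cycle I xs z : Prop :=
  forall b, size b = size xs -> I (koszul_d xs z b).

(** Vanishing of Koszul homology of [R/I] in all degrees [>= i], in terms of
    chains over [R]; chains are inhomogeneous, supported in degrees [>= i]. *)
Definition koszul_exact_above I xs i : Prop :=
  forall z, koszul_cycle I xs z -> low_vanishing xs i z ->
  exists2 y, low_vanishing xs i.+1 y &
    forall b, size b = size xs -> I (z b - koszul_d xs y b).

Lemma count_set_nth_bool b j (v : bool) :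
  (j < size b)%N -> (count id (set_nth false b j v) + nth false b j = count id b + v)%N.
Proof.
elim: b j => [//|a b IHb] [|j] /= j_lt; first by lia.
by rewrite -addnA IHb // addnA.
Qed.

Lemma size_set_nth_bool b j (v : bool) : (j < size b)%N ->
  size (set_nth false b j v) = size b.
Proof. by move=> j_lt; rewrite size_set_nth; apply/maxn_idPr. Qed.

Lemma koszul_d_ideal I xs z b : is_ideal I -> size b = size xs ->
  (forall c, size c = size xs -> I (z c)) -> I (koszul_d xs z b).
Proof.
move=> II sz Iz; apply: koszul_d_closed => // [||f|j j_lt _].
- exact: ideal0.
- by move=> f g; apply: idealD.
- exact: idealN.
- by apply: (idealM _ II); apply: Iz; rewrite size_set_nth_bool ?sz.
Qed.

Lemma koszul_d_low xs i y : low_vanishing xs i.+1 y -> low_vanishing xs i (koszul_d xs y).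
Proof.
move=> y_low b sz b_lt; apply: (koszul_d_closed (P := fun f => f = 0)) => //.
- by move=> f g -> ->; rewrite addr0.
- by move=> f ->; rewrite oppr0.
- move=> j j_lt bj; have j_lt' : (j < size b)%N by rewrite sz.
  rewrite y_low ?mulr0 ?size_set_nth_bool //.
  by have := count_set_nth_bool true j_lt'; rewrite bj; lia.
Qed.

Lemma wedge_low xs p i z : (p < size xs)%N ->
  low_vanishing xs i z -> low_vanishing xs i.+1 (wedge p z).
Proof.
move=> p_lt z_low b sz b_lt; have p_lt' : (p < size b)%N by rewrite sz.
apply: (wedge_closed (P := fun f => f = 0)) => // [f ->|bp]; first by rewrite oppr0.
rewrite z_low ?size_set_nth_bool //.
by have := count_set_nth_bool false p_lt'; rewrite bp; lia.
Qed.

Lemma koszul_kill I xs f i z : is_ideal I ->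
  ideal_span (fun x => x \in xs) f -> koszul_cycle I xs z -> low_vanishing xs i z ->
  exists2 y, low_vanishing xs i.+1 y &
    forall b, size b = size xs -> I (f * z b - koszul_d xs y b).
Proof.
move=> II [t [txs ->]] z_cyc z_low.
elim: t txs => [|[g x] t IHt] txs.
  exists (fun=> 0) => // b sz; rewrite big_nil mul0r koszul_d0 subr0.
  exact: ideal0.
have [|y y_low Iy] := IHt; first by move=> q qt; apply: txs; rewrite inE qt orbT.
have x_xs : x \in xs by apply: (txs (g, x)); rewrite inE eqxx.
have p_lt : (index x xs < size xs)%N by rewrite index_mem.
have w_low := wedge_low p_lt z_low.
exists (fun c => y c + g * wedge (index x xs) z c) => [b sz b_lt|b sz].
  by rewrite y_low // w_low // mulr0 addr0.
have := koszul_homotopy z p_lt sz; rewrite nth_index // => hom.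
have Iw : I (wedge (index x xs) (koszul_d xs z) b).
  apply: wedge_closed; rewrite ?sz //; first exact: ideal0.
    by move=> h; apply: idealN.
  by move=> _; apply: z_cyc; rewrite size_set_nth_bool sz.
rewrite big_cons koszul_dDZ /=.
have := idealD II (Iy b sz) (idealM g II Iw).
congr I; move: hom => /(congr1 (fun h => g * h)); rewrite mulrDr => hom.
by rewrite mulrDl -(mulrA g x) -hom; ring.
Qed.

Lemma bitseq_choice n (Q : bitseq -> R -> Prop) :
  (forall b, size b = n -> exists f, Q b f) ->
  exists z, forall b, size b = n -> Q b (z b).
Proof.
move=> Qex.
have [|z Qz] := @fin_all_exists (n.-tuple bool) (fun=> R) (fun t f => Q t f).
  by move=> t; apply: Qex; rewrite size_tuple.
exists (fun b => if insub b is Some t then z t else 0) => b sz.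
by rewrite insubT /= ?sz // => sz'; apply: (Qz (Tuple sz')).
Qed.

(** Every element [f] of the ideal generated by [xs] kills Koszul homology, so
    [0 -> M -> M -> M/f -> 0] makes [H_(i+1)(M/f)] surject onto [H_i(M)] when
    [f] is a nonzerodivisor. *)
Lemma koszul_exact_regular I xs s i : is_ideal I ->
  (forall f, f \in s -> ideal_span (fun x => x \in xs) f) ->
  weakly_regular I s -> (size xs < i + size s)%N -> koszul_exact_above I xs i.
Proof.
elim: s I i => [|f s IHs] I i II f_xs /= => [_|[If Is]] lt_i z z_cyc z_low.
  exists (fun=> 0) => // b sz; rewrite koszul_d0 subr0 z_low //; first exact: ideal0.
  by apply: leq_ltn_trans (count_size _ _) _; rewrite sz -[i]addn0.
have fI := ideal_add_gen f II.
have fxs : ideal_span (fun x => x \in xs) f by apply: f_xs; rewrite inE eqxx.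
have [y0 y0_low Iy0] := koszul_kill II fxs z_cyc z_low.
have y0_cyc : koszul_cycle (add_gen I f) xs y0.
  move=> b sz; exists (z b); have := idealN II (Iy0 b sz).
  by congr I; ring.
have [w w_low fw] : exists2 w, low_vanishing xs i.+2 w &
    forall b, size b = size xs -> add_gen I f (y0 b - koszul_d xs w b).
  apply: (IHs _ i.+1) y0_cyc y0_low => //; last by rewrite addSnnS.
  by move=> g gs; apply: f_xs; rewrite inE gs orbT.
have [v Pv] : exists v, forall b, size b = size xs ->
    I (y0 b - koszul_d xs w b - f * v b) /\ ((count id b < i.+1)%N -> v b = 0).
  apply: (bitseq_choice (Q := fun b g => I (y0 b - koszul_d xs w b - f * g) /\
    ((count id b < i.+1)%N -> g = 0))) => b sz.
  have [b_lt|b_ge] := ltnP (count id b) i.+1.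
    exists 0; split=> //; rewrite y0_low // (koszul_d_low w_low) //.
    by rewrite mulr0 !subr0; apply: ideal0.
  by have [g Ig] := fw b sz; exists g; split=> //; rewrite [f * g]mulrC.
exists v => [b sz b_lt|b sz]; first by have [_ ->] := Pv b sz.
apply: If.
have Id : I (koszul_d xs (fun c => y0 c - koszul_d xs w c - f * v c) b).
  by apply: koszul_d_ideal => // c sc; have [] := Pv c sc.
have dE : koszul_d xs (fun c => y0 c - koszul_d xs w c - f * v c) b =
          koszul_d xs y0 b - f * koszul_d xs v b.
  rewrite -koszul_dZ (koszul_dB xs (fun c => y0 c - koszul_d xs w c)) koszul_dB.
  by rewrite koszul_dd subr0.
rewrite dE in Id; have := idealD II (Iy0 b sz) Id.
by congr I; ring.
Qed.

(** The complex on [x :: xs] is the mapping cone of [x] on the complex on [xs];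
    where it is exact, [x] acts surjectively on the homology for [xs]. *)
Lemma koszul_divisible I x xs i z : is_ideal I -> koszul_exact_above I (x :: xs) i ->
  koszul_cycle I xs z -> low_vanishing xs i z -> forall t, exists u w,
  [/\ low_vanishing xs i.+1 u, low_vanishing xs i w, koszul_cycle I xs w &
      forall b, size b = size xs -> I (z b - koszul_d xs u b - x ^+ t * w b)].
Proof.
move=> II ex z_cyc z_low; elim=> [|t [u [w [u_low w_low w_cyc Iw]]]].
  exists (fun=> 0), z; split=> // b sz.
  by rewrite koszul_d0 expr0 mul1r subr0 subrr; apply: ideal0.
pose w0 (b : bitseq) := if b is false :: c then w c else 0.
have [||y y_low Iy] := ex w0.
- move=> [//|[] b] [sz] /=; first by rewrite koszul_d0 oppr0; apply: ideal0.
  by rewrite mulr0 addr0; apply: w_cyc.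
- by move=> [//|[] b] [sz] //= b_lt; apply: w_low.
exists (fun c => u c + x ^+ t * y (false :: c)), (fun c => y (true :: c)).
split=> [b sz b_lt|b sz b_lt|b sz|b sz].
- by rewrite u_low // y_low ?mulr0 ?addr0 //=; rewrite sz.
- by rewrite y_low //= sz.
- have := Iy (true :: b); rewrite /= sz => /(_ erefl).
  by rewrite opprK add0r.
- rewrite koszul_dDZ; have := Iy (false :: b); rewrite /= sz => /(_ erefl) Ib.
  have := idealD II (Iw b sz) (idealM (x ^+ t) II Ib).
  by congr I; rewrite exprS; ring.
Qed.

End Koszul.

(** * A Koszul cycle attached to a list of pairs *)

Section PairCycle.

Variable R : comNzRingType.
Implicit Types (b : bitseq) (f w : R) (s : seq (R * R)).

Fixpoint pair_vars s : seq R :=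
  if s is p :: s' then [:: p.1, p.2 & pair_vars s'] else [::].

(** The product [w * prod_p (p.1 e_(p.2) - p.2 e_(p.1))]. *)
Fixpoint pair_cycle s w b : R :=
  match s, b with
  | [::], _ => w
  | p :: s', [:: false, true & b'] => p.1 * pair_cycle s' w b'
  | p :: s', [:: true, false & b'] => - (p.2 * pair_cycle s' w b')
  | _, _ => 0
  end.

(** The first factor of the product is the boundary of [e_(p.1) e_(p.2)]; this is
    that term times the product of the other factors. *)
Definition pair_filling s w b : R :=
  match s, b with
  | _ :: s', [:: true, true & b'] => pair_cycle s' w b'
  | _, _ => 0
  end.

Fixpoint first_bits (n : nat) : bitseq :=
  if n is n'.+1 then [:: true, false & first_bits n'] else [::].

Lemma pair_cycle_closed s w b : koszul_d (pair_vars s) (pair_cycle s w) b = 0.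
Proof.
elim: s b => [|p s IHs] [|[] [|[] b]] //=; rewrite ?koszul_d0 ?mulr0 ?addr0 ?oppr0 //.
- rewrite (koszul_dN _ (fun c => p.2 * pair_cycle s w c)) koszul_dZ IHs.
  by rewrite mulr0 !oppr0.
- by rewrite (koszul_dZ _ _ p.1) IHs mulr0 oppr0.
- by ring.
Qed.

Lemma pair_filling_d p s w b :
  koszul_d (pair_vars (p :: s)) (pair_filling (p :: s) w) b = pair_cycle (p :: s) w b.
Proof.
case: b => [|[] [|[] b]] //=; rewrite ?koszul_d0 ?mulr0 ?addr0 ?oppr0 ?add0r //.
by rewrite pair_cycle_closed !oppr0.
Qed.

Lemma pair_cycle_low s w : low_vanishing (pair_vars s) (size s) (pair_cycle s w).
Proof.
elim: s => [//|p s IHs] [//|[] [//|[] b]] //= [sz] b_lt;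
  by rewrite IHs ?mulr0 ?oppr0 //; lia.
Qed.

Lemma pair_filling_low s w :
  low_vanishing (pair_vars s) (size s).+1 (pair_filling s w).
Proof.
by case: s => [//|p s] [//|[] [//|[] b]] //= [sz] b_lt; apply: pair_cycle_low.
Qed.

Lemma pair_cycle_ideal (I : R -> Prop) s w b : is_ideal I -> I w -> I (pair_cycle s w b).
Proof.
move=> II Iw; elim: s b => [//|p s IHs] [|[] [|[] b]] /=; try exact: ideal0.
  by apply: (idealN II); apply: (idealM _ II).
exact: (idealM _ II).
Qed.

Lemma size_first_bits s : size (first_bits (size s)) = size (pair_vars s).
Proof. by elim: s => [//|p s /= ->]. Qed.

Lemma first_bits_false s j : (j < size (pair_vars s))%N ->
  nth false (first_bits (size s)) j = false ->
  exists2 p, p \in s & (pair_vars s)`_j = p.2.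
Proof.
elim: s j => [//|p s IHs] [|[|j]] //= j_lt; first by exists p; rewrite ?mem_head.
by case/(IHs j j_lt)=> q qs ->; exists q => //; rewrite inE qs orbT.
Qed.

End PairCycle.

(** * Koszul homology over subsets of the variables *)

Section PolynomialKoszul.

Variables (K : fieldType) (d : nat).
Local Notation S := {mpoly K[d]}.
Implicit Types (I : S -> Prop) (vs : seq 'I_d) (i : 'I_d) (D j : nat).

Definition varseq vs : seq S := [seq 'X_i | i <- vs].

Lemma trunc_koszul_d D vs z b :
  trunc D (koszul_d (varseq vs) z b) =
  koszul_d (varseq vs) (fun c => trunc D.-1 (z c)) b.
Proof.
rewrite /varseq; elim: vs b z => [|i vs IHvs] [|[] b] z /=; rewrite ?linear0 //.
  by rewrite linearN /= IHvs.
by rewrite linearD /= IHvs mulrC (@truncM _ _ _ 1) ?subn1 1?mulrC // dhomogX /= mdeg1.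
Qed.

(** Graded Nakayama: if a cycle is, modulo a boundary, divisible by every power of
    a variable, take the power [D] for [D] above the degrees of its coefficients.
    Truncating at [D] fixes the cycle and kills the multiple of [X_i ^ D], so the
    cycle is the truncated boundary. *)
Lemma koszul_exact_behead I i vs j : is_ideal I -> graded I ->
  koszul_exact_above I (varseq (i :: vs)) j -> koszul_exact_above I (varseq vs) j.
Proof.
move=> II gI ex z z_cyc z_low.
pose D := (\max_(t : (size (varseq vs)).-tuple bool) msize (z t))%N.
have [u [w [u_low _ _ Iw]]] := koszul_divisible II ex z_cyc z_low D.
exists (fun c => trunc D.-1 (u c)) => [b sz b_lt|b sz].
  by rewrite u_low // linear0.
have := gI D _ (Iw b sz); rewrite !linearB /= trunc_Xn subr0 trunc_koszul_d.
rewrite trunc_id //.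
have -> : b = tval (tcast sz (in_tuple b)) by rewrite val_tcast.
exact: (@leq_bigmax _ (fun t : (size (varseq vs)).-tuple bool => msize (z t))).
Qed.

Lemma koszul_exact_drop I us vs j : is_ideal I -> graded I ->
  koszul_exact_above I (varseq (us ++ vs)) j -> koszul_exact_above I (varseq vs) j.
Proof.
move=> II gI; elim: us => [//|i us IHus] ex.
exact/IHus/(koszul_exact_behead II gI ex).
Qed.

End PolynomialKoszul.

(** * Non-exactness along an induced matching *)

Section UpperBound.

Variables (K : fieldType) (d : nat) (e : rel 'I_d) (k : nat).
Hypothesis k_gt0 : (0 < k)%N.
Local Notation S := {mpoly K[d]}.
Implicit Types (s : seq ('I_d * 'I_d)) (v : 'I_d) (b : bitseq).

Definition flat s : seq 'I_d := flatten [seq [:: p.1; p.2] | p <- s].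

Definition induced_pairs s : Prop :=
  [/\ uniq (flat s), forall p, p \in s -> e p.1 p.2 &
      forall u v, u \in flat s -> v \in flat s -> e u v ->
        (u, v) \in s \/ (v, u) \in s].

(** Outside the matched vertices the exponent [k] makes every edge bound hold;
    at a matched edge the sum is [k - 1], one short of the bound, and either
    endpoint supplies the missing factor. *)
Definition base_exponent s : 'X_{1..d} :=
  [multinom (if v \in map fst s then k.-1 else if v \in map snd s then 0%N else k)
    | v < d].

Definition varpairs s : seq (S * S) := [seq ('X_p.1, 'X_p.2) | p <- s].

Lemma pair_vars_varpairs s : pair_vars (varpairs s) = varseq K (flat s).
Proof. by elim: s => [//|p s /= ->]. Qed.

Lemma fst_flat s p : p \in s -> p.1 \in flat s.
Proof. by move=> ps; apply/flatten_mapP; exists p; rewrite ?inE ?eqxx. Qed.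

Lemma snd_flat s p : p \in s -> p.2 \in flat s.
Proof. by move=> ps; apply/flatten_mapP; exists p; rewrite ?inE ?eqxx ?orbT. Qed.

Lemma flat_mem s v : (v \in flat s) = (v \in map fst s) || (v \in map snd s).
Proof.
apply/flatten_mapP/orP=> [[p ps]|[]/mapP[p ps ->]].
- by rewrite !inE => /orP[]/eqP->; [left | right]; apply: map_f.
- by exists p; rewrite ?inE ?eqxx.
- by exists p; rewrite ?inE ?eqxx ?orbT.
Qed.

Lemma uniq_flat_snd s p : uniq (flat s) -> p \in s ->
  p.2 \notin map fst s /\ count_mem p.2 (map snd s) = 1%N.
Proof.
elim: s => [//|q s IHs] /= /and3P[]; rewrite inE negb_or => /andP[q12 q1s] q2s us.
rewrite inE => /predU1P[->|ps].
  move: (q2s); rewrite flat_mem negb_or => /andP[q2f q2sn].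
  by rewrite inE eq_sym negb_or q12 q2f eqxx (count_memPn q2sn).
have [p2f p2c] := IHs us ps; have p2s := snd_flat ps.
rewrite inE negb_or p2f p2c andbT.
by split; [apply: contraNneq q1s => <- | case: eqP q2s => [->|//]; rewrite p2s].
Qed.

Lemma uniq_flat_fst s p : uniq (flat s) -> p \in s -> p.1 \notin map snd s.
Proof.
elim: s => [//|q s IHs] /= /and3P[]; rewrite inE negb_or => /andP[q12 q1s] q2s us.
rewrite inE => /predU1P[->|ps].
  by rewrite inE negb_or q12; move: q1s; rewrite flat_mem negb_or => /andP[].
rewrite inE negb_or (IHs us ps) andbT.
by apply: contraNneq q2s => <-; apply: fst_flat.
Qed.

Lemma pair_cycle_edge s p w b : p \in s ->
  mono_ideal (fun m => k.-1 <= m p.1 + m p.2)%N w ->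
  mono_ideal (fun m => k <= m p.1 + m p.2)%N (pair_cycle (varpairs s) w b).
Proof.
have edgeI c : is_ideal (@mono_ideal K d (fun m => c <= m p.1 + m p.2)%N).
  by apply: mono_ideal_is_ideal => m n; rewrite !mnmDE; lia.
elim: s b => [//|q s IHs] b; rewrite inE => /predU1P[<-|ps] wI; last first.
  have IH c := IHs c ps wI.
  case: b => [|[] [|[] b]] /=; try exact: ideal0 (edgeI k).
    by apply: (idealN (edgeI k)); apply: (idealM _ (edgeI k)).
  exact: (idealM _ (edgeI k)).
have IH c := pair_cycle_ideal (varpairs s) c (edgeI k.-1) wI.
case: b => [|[] [|[] b]] /=; try exact: ideal0 (edgeI k).
  apply: (idealN (edgeI k)); apply/mono_idealMX => m /IH.
  by rewrite !mnmDE !mnm1E eqxx /=; lia.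
by apply/mono_idealMX => m /IH; rewrite !mnmDE !mnm1E eqxx /=; lia.
Qed.

Lemma pair_cycle_order s b : induced_pairs s ->
  order_ideal e k (pair_cycle (varpairs s) 'X_[base_exponent s] b).
Proof.
case=> _ _ ind m m_in u v uv; rewrite !mnm0E !add0n.
have wE : (base_exponent s u = if u \in flat s then base_exponent s u else k) /\
          (base_exponent s v = if v \in flat s then base_exponent s v else k).
  by rewrite !mnmE !flat_mem; do 2!case: (_ \in map fst s); do 2!case: (_ \in map snd s).
have edge p : p \in s -> (k <= m p.1 + m p.2)%N.
  move=> ps; apply: (pair_cycle_edge (b := b) ps _ m_in).
  by apply/mono_ideal_mon; rewrite !mnmE map_f //; apply: leq_addr.
have out : (k <= base_exponent s u + base_exponent s v)%N -> (k <= m u + m v)%N.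
  move=> le_k; have edgeI : is_ideal (@mono_ideal K d (fun m => k <= m u + m v)%N).
    by apply: mono_ideal_is_ideal => m1 n1; rewrite !mnmDE; lia.
  apply: (pair_cycle_ideal (varpairs s) b edgeI _ m m_in).
  exact/mono_ideal_mon.
case: wE; have [us _|_ bu _] := boolP (u \in flat s); last first.
  by apply: out; rewrite bu leq_addr.
have [vs _|_ bv] := boolP (v \in flat s); last by apply: out; rewrite bv leq_addl.
by case: (ind u v us vs uv) => /edge //=; rewrite addnC.
Qed.

Definition top_exponent s : 'X_{1..d} :=
  (\sum_(p <- s) U_(p.2) + base_exponent s)%MM.

Lemma pair_cycle_top s w : exists2 c : K, c != 0 &
  pair_cycle (varpairs s) 'X_[w] (first_bits (size (varpairs s))) =
  c *: 'X_[\sum_(p <- s) U_(p.2) + w].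
Proof.
elim: s => [|p s [c c0 IHs]] /=.
  by exists 1; rewrite ?oner_eq0 // big_nil add0m scale1r.
exists (- c); first by rewrite oppr_eq0.
by rewrite IHs big_cons !mpolyXD scaleNr -scalerAr mulrA.
Qed.

Lemma top_exponent_edge s p : induced_pairs s -> p \in s ->
  (top_exponent s p.1 + top_exponent s p.2 = k)%N.
Proof.
case=> us _ _ ps.
have sumE v : (\sum_(q <- s) U_(q.2)%MM v = count_mem v (map snd s))%N.
  by elim: (s) => [|q t IHt]; rewrite ?big_nil // big_cons mnm1E IHt.
have [p2f p2c] := uniq_flat_snd us ps.
rewrite /top_exponent !mnmDE !mnm_sumE !sumE p2c (count_memPn (uniq_flat_fst us ps)).
rewrite !mnmE map_f // (negPf p2f) map_f //. lia.
Qed.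

(** The class of [pair_filling] is nonzero: if it bounded modulo the ideal, its
    boundary [pair_cycle] would be the boundary of a chain with values in the
    ideal.  At the face of all first endpoints the former has the monomial
    [top_exponent s], whereas each term of the latter is a second endpoint
    [x_p.2] times an element of the ideal, and
    [top_exponent s - U_(p.2)] has order [k - 1] only at the edge [p]. *)
Lemma koszul_not_exact s : s != [::] -> induced_pairs s ->
  ~ koszul_exact_above (order_ideal e k) (varseq K (flat s)) (size s).+1.
Proof.
case: s => [//|p0 s0] _; set s := p0 :: s0 => s_ind ex.
have II := order_ideal_is_ideal K e k.
pose w : S := 'X_[base_exponent s].
pose z := pair_filling (varpairs s) w.
have dz b : koszul_d (varseq K (flat s)) z b = pair_cycle (varpairs s) w b.
  by rewrite -pair_vars_varpairs; apply: pair_filling_d.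
have sizeE : size (varpairs s) = size s by rewrite size_map.
have [||y _ Iy] := ex z.
- by move=> b _; rewrite dz; apply: pair_cycle_order.
- by rewrite -pair_vars_varpairs -sizeE; apply: pair_filling_low.
pose b0 := first_bits (size (varpairs s)).
have sb0 : size b0 = size (varseq K (flat s)).
  by rewrite -pair_vars_varpairs size_first_bits.
have [c c0 top] := pair_cycle_top s (base_exponent s).
suff : (koszul_d (varseq K (flat s))
   (fun b => z b - koszul_d (varseq K (flat s)) y b) b0)@_(top_exponent s) = 0.
  rewrite koszul_dB koszul_dd subr0 dz top mcoeffZ mcoeffX eqxx mulr1.
  by move/eqP; rewrite (negPf c0).
apply: (koszul_d_closed (P := fun f => f@_(top_exponent s) = 0)) => //.
- by rewrite mcoeff0.
- by move=> f g f0 g0; rewrite mcoeffD f0 g0 addr0.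
- by move=> f f0; rewrite mcoeffN f0 oppr0.
move=> j j_lt b0j; rewrite -pair_vars_varpairs in j_lt *.
have [_ /mapP[p ps ->] /= ->] := first_bits_false j_lt b0j.
rewrite pair_vars_varpairs.
set g := z _ - _.
have Ig : order_ideal e k g.
  by apply: Iy; rewrite size_set_nth_bool // sb0 -pair_vars_varpairs.
apply/eqP; rewrite mcoeff_eq0 mulrC (perm_mem (msuppMX _ _)).
apply/negP=> /mapP[m mg topE].
case: (s_ind) => _ es _; have := Ig m mg _ _ (es p ps).
have := top_exponent_edge s_ind ps; rewrite topE !mnmDE !mnm1E !mnm0E eqxx.
lia.
Qed.

End UpperBound.

(** * Induced matchings as lists of pairs *)

Section InducedMatchings.

Variables (d : nat) (e : rel 'I_d).
Hypothesis e_irr : irreflexive e.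

Lemma ind_match_gt0 x y : e x y -> (0 < ind_match e)%N.
Proof.
move=> xy; rewrite -(cards1 [set x; y]); apply: leq_bigmax_cond.
apply/andP; split; first (apply/andP; split).
- by rewrite sub1set; apply/imsetP; exists (x, y); rewrite ?inE.
- by apply/trivIsetP=> A B /set1P-> /set1P->; rewrite eqxx.
- apply/forall_inP=> A /set1P->; apply/forall_inP=> B /set1P->.
  by rewrite eqxx.
Qed.

Lemma induced_pairs_exist :
  exists2 s, induced_pairs e s & size s = ind_match e.
Proof.
have [|M Mind maxM] := @eq_bigmax_cond _ [pred M | induced_matching e M] (fun M => #|M|).
  apply/card_gt0P; exists set0; rewrite inE; apply/andP; split; last first.
    by apply/forall_inP=> A; rewrite inE.
  by rewrite /matching sub0set; apply/trivIsetP=> A B; rewrite inE.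
pose E (p : 'I_d * 'I_d) := [set p.1; p.2].
case/andP: (Mind) => /andP[/subsetP Medge /trivIsetP Mtriv] /forall_inP Mno.
have [s sE es] : exists2 s, map E s = enum M & forall p, p \in s -> e p.1 p.2.
  have : {subset enum M <= M} by move=> A; rewrite mem_enum.
  elim: (enum M) => [|A l IHl] lM; first by exists [::].
  have /imsetP[p] := Medge A (lM A (mem_head _ _)); rewrite inE => ep defA.
  have [|s sE es] := IHl; first by move=> B Bl; apply: lM; rewrite inE Bl orbT.
  exists (p :: s) => [|q]; first by rewrite /= sE defA.
  by rewrite inE => /predU1P[->|/es].
have sM p : p \in s -> E p \in M by move=> ps; rewrite -mem_enum -sE; apply: map_f.
exists s; last by rewrite -(size_map E) sE -cardE /ind_match maxM.
have memE p u : (u \in E p) = (u \in [:: p.1; p.2]) by rewrite !inE.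
split=> //.
  have : uniq (map E s) by rewrite sE enum_uniq.
  elim: s es sM {sE} => [//|p s IHs] es sM /= /andP[pNs us].
  have es' q : q \in s -> e q.1 q.2 by move=> qs; apply: es; rewrite inE qs orbT.
  have sM' q : q \in s -> E q \in M by move=> qs; apply: sM; rewrite inE qs orbT.
  rewrite inE negb_or (IHs es' sM' us) andbT.
  have out u : u \in E p -> u \notin flat s.
    move=> up; apply/negP=> /flatten_mapP[q qs]; rewrite -memE => uq.
    have neE : E p != E q by apply: contraNneq pNs => ->; apply: map_f.
    have := Mtriv _ _ (sM p (mem_head _ _)) (sM' q qs) neE.
    by move/pred0P/(_ u); rewrite /= up uq.
  rewrite !out ?memE ?inE ?eqxx ?orbT // !andbT.
  by apply/eqP=> p12; have := es p (mem_head _ _); rewrite p12 e_irr.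
move=> u v /flatten_mapP[p ps]; rewrite -memE => up.
move=> /flatten_mapP[q qs]; rewrite -memE => vq uv.
have [Epq|neE] := eqVneq (E p) (E q); last first.
  have /forall_inP/(_ _ (sM q qs)) := Mno _ (sM p ps).
  by rewrite neE => /forall_inP/(_ u up)/forall_inP/(_ v vq); rewrite uv.
move: vq; rewrite -Epq; move: up; rewrite !inE.
have p_eq : (p.1, p.2) \in s by rewrite -surjective_pairing.
case/orP=> /eqP def_u /orP[]/eqP def_v; rewrite def_u def_v ?e_irr in uv *;
  by [left | right | ].
Qed.

End InducedMatchings.

(** * Constant terms *)

Section IrrelevantIdeal.

Variables (K : fieldType) (d : nat).
Local Notation S := {mpoly K[d]}.

(** Phrased as a monomial ideal, although it is the kernel of the constant term,
    so that it compares directly with the powers of the cover ideal. *)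
Definition nonconstant_ideal : S -> Prop := mono_ideal (fun m => m != 0%MM).

Lemma nonconstant_is_ideal : is_ideal nonconstant_ideal.
Proof.
by apply: mono_ideal_is_ideal => m n m0; rewrite mnmD_eq0 negb_and m0 orbT.
Qed.

Lemma nonconstant1 : ~ nonconstant_ideal 1.
Proof. by rewrite -mpolyX0 => /mono_ideal_mon; rewrite eqxx. Qed.

Lemma irrelevant_nonconstant f : @irrelevant_ideal K d f -> nonconstant_ideal f.
Proof.
apply: ideal_span_sub; first exact: nonconstant_is_ideal.
by move=> _ [i ->]; apply/mono_ideal_mon; rewrite mnm1_eq0.
Qed.

Lemma mesyms_irrelevant n f : f \in mesyms K d n -> irrelevant_ideal f.
Proof.
have II := ideal_span_is_ideal (fun f : S => exists i : 'I_d, f = 'X_i).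
case/mapP=> j _ ->; apply: ideal_sum => // h /eqP h_card.
have /card_gt0P[i ih] : (0 < #|h|)%N by rewrite h_card.
rewrite (bigD1 i) //= mulrC; apply: (idealM _ II).
by apply: mem_ideal_span; exists i.
Qed.

End IrrelevantIdeal.

(** * The depth of powers of the cover ideal *)

Theorem theorem2p1 (K : fieldType) (d : nat) (d_gt0 : (0 < d)%N)
    (e : rel 'I_d) (e_sym : ssrbool.symmetric e) (e_irr : irreflexive e)
    (e_bip : bipartite e) (e_noiso : no_isolated e)
    (e_match : ind_match e = ord_match e) (k : nat) (k_gt0 : (1 <= k)%N) :
  is_quot_depth (ideal_pow (@cover_ideal K d e) k) (d - ind_match e - 1)%N.
Proof.
have powE := ideal_pow_cover (K := K) k e_bip.
have II := ideal_span_is_ideal (fun f => exists t : k.-tuple {mpoly K[d]},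
  (forall g, g \in t -> @cover_ideal K d e g) /\ f = \prod_(g <- t) g).
have OI := order_ideal_is_ideal K e k.
have [y xy] := e_noiso (Ordinal d_gt0).
have ind_gt0 := ind_match_gt0 xy.
split.
  exists (mesyms K d (d - ind_match e - 1)); last by rewrite size_map size_iota.
  split; first exact: mesyms_irrelevant.
  split.
    apply/(weakly_regularP _ II)/(weakly_regular_ext (same_ideal_sym powE)).
    have [->|n_gt0] := posnP (d - ind_match e - 1); first by [].
    have n_bound s : ordered_pairs e s -> (size s + (d - ind_match e - 1) < d)%N.
      by move/(ordered_pairs_leq e_sym e_irr); rewrite -e_match; lia.
    have reg : state_regular K e k (d - ind_match e - 1) 0%MM (firsts [::]).
      by apply: state_regular_avoiding.
    apply: weakly_regular_ext reg; apply: mono_ideal_ext => m.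
    by split=> [[[z]|//]|]; [rewrite inE | right].
  move=> I1; apply: (@nonconstant1 K d); apply: ideal_span_sub I1.
    exact: nonconstant_is_ideal.
  move=> g [/powE Ig|/mesyms_irrelevant/irrelevant_nonconstant //] m /Ig/(_ _ _ xy).
  by apply: contraTneq => ->; rewrite !mnm0E -ltnNge.
move=> s [s_irr [s_reg _]]; rewrite leqNgt; apply/negP=> s_long.
have {}s_reg : weakly_regular (order_ideal e k) s.
  exact/(weakly_regular_ext powE)/(weakly_regularP _ II).
have [ps ps_ind ps_size] := induced_pairs_exist e_irr.
have [us _ _] := ps_ind.
pose outs := [seq v <- enum 'I_d | v \notin flat ps].
have all_vars v : v \in outs ++ flat ps.
  by rewrite mem_cat mem_filter mem_enum andbT orNb.
have vars_uniq : uniq (outs ++ flat ps).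
  rewrite cat_uniq us filter_uniq ?enum_uniq //= andbT.
  by apply/hasPn=> v vps; rewrite mem_filter vps.
have vars_size : (size (outs ++ flat ps) <= d)%N.
  by rewrite -[leqRHS](card_ord d) -(card_uniqP vars_uniq); apply: max_card.
have ps_nil : ps != [::] by rewrite -size_eq0 ps_size -lt0n.
apply: (koszul_not_exact (K := K) k_gt0 ps_nil ps_ind).
apply: (koszul_exact_drop (us := outs)) => //; first exact: graded_mono_ideal.
apply: (koszul_exact_regular OI _ s_reg); last first.
  rewrite size_map ps_size; apply: leq_ltn_trans vars_size _.
  by move: (size s) s_long => c; lia.
move=> f /s_irr; apply: ideal_span_sub; first exact: ideal_span_is_ideal.
by move=> _ [v ->]; apply/mem_ideal_span/map_f.
Qed.
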